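(* Let $d$ be prime, $n\ge1$, $\rho$ an $n$-qudit state and $\alpha\ge 1$. Then $$\min_{\sigma\in \mathrm{MSPS}}D_\alpha(\rho\|\sigma)=D_\alpha(\rho\|\mathcal M(\rho))=H_\alpha(\mathcal M(\rho))-H_\alpha(\rho),$$ where the minimum is over all $n$-qudit MSPSs. Moreover $\mathcal M(\rho)$ is the unique minimizer: for every MSPS $\sigma\neq\mathcal M(\rho)$, $D_\alpha(\rho\|\sigma)>D_\alpha(\rho\|\mathcal M(\rho))$.
   Context: Fix a prime $d$ and $n\ge1$. Let $\mathcal H=\mathbb C^d$ with computational basis $\{|k\rangle\}_{k\in\mathbb Z_d}$, $\chi(k)=e^{2\pi i k/d}$, $X|k\rangle=|k+1\rangle$, $Z|k\rangle=\chi(k)|k\rangle$. For $(p,q)\in\mathbb Z_d^2$ the Weyl operator is $w(p,q)=\chi(-2^{-1}pq)Z^pX^q$ if $d$ is odd and $w(p,q)=i^{-pq}Z^pX^q$ if $d=2$. Let $V^n=\mathbb Z_d^n\times\mathbb Z_d^n$ and $w(\vec p,\vec q)=\bigotimes_{k}w(p_k,q_k)$. The characteristic function of a state $\rho$ is $\Xi_\rho(\vec p,\vec q)=\mathrm{Tr}[\rho\,w(-\vec p,-\vec q)]$. For an abelian group $S$ of Weyl operators (up to phases), a minimal projection of the C*-algebra generated by $S$ divided by its rank is a minimal stabilizer-projection state (MSPS). The mean state $\mathcal M(\rho)$ is the operator with $\Xi_{\mathcal M(\rho)}(\vec x)=\Xi_\rho(\vec x)$ if $|\Xi_\rho(\vec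 x)|=1$ and $0$ otherwise. The sandwiched quantum Rényi relative entropy is $D_\alpha(\rho\|\sigma)=\frac{1}{\alpha-1}\log\mathrm{Tr}\big[(\sigma^{\frac{1-\alpha}{2\alpha}}\rho\,\sigma^{\frac{1-\alpha}{2\alpha}})^\alpha\big]$ (with the usual limits at $\alpha=1,\infty$ and $+\infty$ if the support of $\rho$ is not contained in that of $\sigma$), and $H_\alpha(\rho)=\frac{1}{1-\alpha}\log\mathrm{Tr}\rho^\alpha$ (with limits at $\alpha=1,\infty$). *)

(* Defs.v *)
(* mathcomp + mathcomp-analysis (reals, ln, powR, cos, sin, pi)
   + real-closed's complex numbers R[i] + mathcomp's spectral theorem. *)
From mathcomp Require Import all_boot all_order all_algebra.
From mathcomp Require Import spectral complex.
From mathcomp Require Import boolp classical_sets reals constructive_ereal ereal exp trigo.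

Set Implicit Arguments.
Unset Strict Implicit.
Unset Printing Implicit Defensive.

Import Order.TTheory GRing.Theory Num.Theory.
Local Open Scope ring_scope.
Local Open Scope complex_scope.
Local Open Scope sesquilinear_scope.

(* Labels of the computational basis of (C^d)^{\otimes n}: functions 'I_n -> Z_d. *)
Notation cfg d n := {ffun 'I_n -> 'Z_d}.
(* Phase space V^n = Z_d^n x Z_d^n; a point is (p, q). *)
Notation phsp d n := (cfg d n * cfg d n)%type.
(* Operators on the n-qudit Hilbert space, as #|cfg d n| x #|cfg d n| complex
   matrices; row/column index i stands for the basis vector |enum_val i>. *)
Notation op R d n := 'M[R[i]]_(#|{: cfg d n}|).

Section Qudit.
Variable R : realType.
Variables d n : nat.

(* chi(k) = exp(2 pi i k / d) *)
Definition chi (k : 'Z_d) : R[i] :=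
  let t := (2 * pi * (nat_of_ord k)%:R / d%:R : R) in (cos t) +i* (sin t).

(* Phase factor of the single-qudit Weyl operator w(p,q):
   chi(-2^{-1} p q) for odd d, i^{-pq} for d = 2. *)
Definition weyl_phase (p q : 'Z_d) : R[i] :=
  if d == 2%N then ('i ^+ (nat_of_ord p * nat_of_ord q)%N)^-1
  else chi (- ((2%:R : 'Z_d)^-1 * p * q)).

(* Matrix entry <a| w(p,q) |b> = phase * [a = b + q] * chi(p a),
   since Z^p X^q |b> = chi(p (b+q)) |b+q>. *)
Definition weyl1 (p q a b : 'Z_d) : R[i] :=
  weyl_phase p q * (a == b + q)%:R * chi (p * a).

(* n-qudit Weyl operator w(p,q) = tensor product of the w(p_k,q_k). *)
Definition weyl (x : phsp d n) : op R d n :=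
  \matrix_(i, j) \prod_(k < n)
     weyl1 (x.1 k) (x.2 k) ((enum_val i : cfg d n) k) ((enum_val j : cfg d n) k).

(* Characteristic function Xi_rho(x) = Tr[rho w(-x)]. *)
Definition charfun (rho : op R d n) (x : phsp d n) : R[i] :=
  \tr (rho *m weyl (- x)).

(* The mean state: the operator whose characteristic function equals
   Xi_rho(x) where |Xi_rho(x)| = 1 and 0 elsewhere. *)
Definition mean_state (rho : op R d n) : op R d n :=
  xget 0 (fun M : op R d n => forall x : phsp d n,
    charfun M x = if `|charfun rho x| == 1 then charfun rho x else 0).

(* Positive semidefinite operators and states. *)
Definition psd (A : op R d n) : Prop :=
  A ^t* = A /\ forall v : 'cV[R[i]]_(#|{: cfg d n}|), 0 <= (v ^t* *m A *m v) 0 0.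

Definition state (rho : op R d n) : Prop := psd rho /\ \tr rho = 1.

(* --- Minimal stabilizer-projection states --- *)

(* The *-algebra (= C*-algebra, in finite dimension) generated by
   {w(x) : x in S}: the smallest set of operators containing them and
   closed under sums, scalar multiples, products and adjoints. *)
Definition gen_alg (S : {set phsp d n}) (A : op R d n) : Prop :=
  forall P : op R d n -> Prop,
    (forall x, x \in S -> P (weyl x)) ->
    (forall B C, P B -> P C -> P (B + C)) ->
    (forall (c : R[i]) B, P B -> P (c *: B)) ->
    (forall B C, P B -> P C -> P (B *m C)) ->
    (forall B, P B -> P (B ^t*)) ->
    P A.

Definition is_proj (P : op R d n) : Prop := P *m P = P /\ P ^t* = P.

(* Minimal (nonzero) projection of the generated algebra. *)
Definition min_proj (S : {set phsp d n}) (P : op R d n) : Prop :=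
  [/\ gen_alg S P, is_proj P, P <> 0 &
      forall Q, gen_alg S Q -> is_proj Q -> Q <> 0 -> Q *m P = Q -> Q = P].

(* S (a subgroup of V^n) labels an abelian group of Weyl operators up to
   phases: it contains 0 (the identity), is closed under addition
   (w(x) w(y) is proportional to w(x+y)) and the w(x), x in S, commute. *)
Definition abelian_weyl_group (S : {set phsp d n}) : Prop :=
  [/\ 0 \in S,
      (forall x y, x \in S -> y \in S -> x + y \in S) &
      (forall x y, x \in S -> y \in S -> weyl x *m weyl y = weyl y *m weyl x)].

Definition MSPS (sigma : op R d n) : Prop :=
  exists (S : {set phsp d n}) (P : op R d n),
    [/\ abelian_weyl_group S, min_proj S P & sigma = ((\rank P)%:R)^-1 *: P].

(* --- Functional calculus for Hermitian (normal) operators --- *)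
(* A = U^-1 diag(l) U with U unitary (mathcomp's spectral theorem);
   f(A) := U^-1 diag(f(l)) U, applied to the (real) eigenvalues. *)
Definition mxfun (f : R -> R) (A : op R d n) : op R d n :=
  invmx (spectralmx A) *m
    diag_mx (map_mx (fun z : R[i] => (f (complex.Re z))%:C) (spectral_diag A))
  *m spectralmx A.

(* A^s for PSD A, with 0^s = 0 for s <> 0 (powR convention), i.e. negative
   powers are taken on the support (generalized inverse). *)
Definition mxpow (s : R) (A : op R d n) : op R d n := mxfun (fun t => t `^ s) A.

(* Largest eigenvalue of a Hermitian (here PSD) operator. *)
Definition lambda_max (A : op R d n) : R :=
  \big[Num.max/0]_(i < #|{: cfg d n}|) complex.Re (spectral_diag A 0 i).

Definition reTr (A : op R d n) : R := complex.Re (\tr A).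

(* supp rho contained in supp sigma (Hermitian operators): ker sigma <= ker rho *)
Definition supp_le (rho sigma : op R d n) : Prop :=
  forall v : 'cV[R[i]]_(#|{: cfg d n}|), sigma *m v = 0 -> rho *m v = 0.

(* Sandwiched Renyi relative entropy (finite part), for alpha in [1, +oo]:
   alpha = 1 : Umegaki relative entropy Tr rho (log rho - log sigma);
   alpha = +oo : max-relative entropy log || sigma^{-1/2} rho sigma^{-1/2} ||;
   otherwise : 1/(alpha-1) log Tr[(sigma^{(1-a)/2a} rho sigma^{(1-a)/2a})^a]. *)
Definition sandwiched_fin (alpha : \bar R) (rho sigma : op R d n) : R :=
  match alpha with
  | +oo%E => let S := mxpow (- 2^-1) sigma in ln (lambda_max (S *m rho *m S))
  | (a%:E)%E =>
      if a == 1 then reTr (rho *m (mxfun (@ln R) rho - mxfun (@ln R) sigma))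
      else let S := mxpow ((1 - a) / (2 * a)) sigma in
           (a - 1)^-1 * ln (reTr (mxpow a (S *m rho *m S)))
  | -oo%E => 0 (* not used: alpha >= 1 *)
  end.

Definition sandwiched (alpha : \bar R) (rho sigma : op R d n) : \bar R :=
  if `[< supp_le rho sigma >] then (sandwiched_fin alpha rho sigma)%:E
  else +oo%E.

(* Renyi entropy H_alpha, alpha in [1, +oo] (alpha = 1: von Neumann,
   alpha = +oo: min-entropy -log lambda_max). *)
Definition renyi (alpha : \bar R) (rho : op R d n) : R :=
  match alpha with
  | +oo%E => - ln (lambda_max rho)
  | (a%:E)%E =>
      if a == 1 then - reTr (rho *m mxfun (@ln R) rho)
      else (1 - a)^-1 * ln (reTr (mxpow a rho))
  | -oo%E => 0 (* not used *)
  end.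

End Qudit.

(* Main.v *)
Require Import Defs.
From mathcomp Require Import all_boot all_order all_algebra.
From mathcomp Require Import spectral complex ring lra.
From mathcomp Require Import boolp classical_sets reals constructive_ereal ereal exp trigo.

Set Implicit Arguments.
Unset Strict Implicit.
Unset Printing Implicit Defensive.

Import Order.TTheory GRing.Theory Num.Theory.
Local Open Scope ring_scope.
Local Open Scope complex_scope.
Local Open Scope sesquilinear_scope.

(** For a minimal projection P of the algebra generated by the [w(x)], x in S, each [w(x)]
    acts on P as a scalar [lam x] of modulus 1, so P is the character average
    [|S|^-1 \sum_(x in S) (lam x)^* w(x)], of rank d^n / |S|.  The state P / rank P has
    spectrum in {0, 1 / rank P}, so powers and logarithms of it are multiples of P: if P
    fixes rho then
    [D_alpha(rho || P / rank P) = ln (rank P) - H_alpha(rho)]; otherwise the divergence is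
    infinite.  Equality in [|tr(rho U)| <= 1] shows that [|Xi_rho(x)| = 1] means that
    [w(-x)] acts on rho as the scalar [Xi_rho(x)].  Hence these x form an isotropic group
    G with M(rho) its stabilizer state, and a stabilizer projection fixes rho exactly when
    its group lies in G with the same eigenvalues.  G is thus the largest such group and
    gives the smallest rank, strictly so for any other choice. *)

(** * Single-qudit Weyl operators *)

Section Characters.
Variables (R : realType) (d : nat).
Hypothesis d_gt1 : (1 < d)%N.
Local Notation chi := (@chi R d).
Local Notation weyl_phase := (@weyl_phase R d).
Local Notation weyl1 := (@weyl1 R d).

Let expi (t : R) : R[i] := cos t +i* sin t.

Let expiD s t : expi (s + t) = expi s * expi t.
Proof. by rewrite /expi sinD cosD [X in _ +i* X]addrC. Qed.

Let expi_mulrn t k : expi (t *+ k) = expi t ^+ k.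
Proof.
elim: k => [|k IH]; first by rewrite mulr0n /expi cos0 sin0.
by rewrite mulrS expiD IH exprS.
Qed.

Let root1 := expi (2 * pi / d%:R).

Let chiE k : chi k = root1 ^+ k.
Proof.
rewrite /Defs.chi -/(expi _) /root1 -expi_mulrn; congr expi.
by rewrite mulrAC mulr_natr.
Qed.

Let root1_order : root1 ^+ d = 1.
Proof.
have d0 : d%:R != 0 :> R by rewrite pnatr_eq0 -lt0n ltnW.
rewrite /root1 -expi_mulrn -[_ *+ d]mulr_natr divfK //.
by rewrite /expi mulrC mulr_natr cos2pi sin2pi.
Qed.

Lemma chi0 : chi 0 = 1.
Proof. by rewrite chiE expr0. Qed.

Lemma chiD a b : chi (a + b) = chi a * chi b.
Proof.
have root1_mod m : root1 ^+ (m %% (Zp_trunc d).+2) = root1 ^+ m.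
  by rewrite Zp_cast // {2}(divn_eq m d) exprD mulnC exprM root1_order expr1n mul1r.
by rewrite !chiE /= root1_mod exprD.
Qed.

Lemma norm_chi a : `|chi a| = 1.
Proof. by rewrite normc_def /= cos2Dsin2 sqrtr1. Qed.

Lemma chi_neq0 a : chi a != 0.
Proof. by rewrite -normr_gt0 norm_chi. Qed.

Lemma chiN a : chi (- a) = (chi a)^-1.
Proof.
by apply: (mulfI (chi_neq0 a)); rewrite -chiD subrr chi0 divff ?chi_neq0.
Qed.

Lemma conj_chi a : (chi a)^*%R = chi (- a).
Proof.
by apply: (mulfI (chi_neq0 a)); rewrite -normCK norm_chi expr1n chiN divff ?chi_neq0.
Qed.

(** With t = 2 pi a / d, the double-angle formula turns cos t = 1 into sin (t/2) = 0. For 0 < a < d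
    the angle t/2 lies strictly between 0 and pi, where the sine is positive. *)
Lemma chi_eq1 a : (chi a == 1) = (a == 0).
Proof.
apply/eqP/eqP => [|->]; last exact: chi0.
case=> cos_eq1 _; apply/val_inj => /=.
have d0 : 0 < d%:R :> R by rewrite ltr0n ltnW.
have lead : (a < d)%N by case: (a) => m /=; rewrite Zp_cast.
set t := 2 * pi * _ / _ in cos_eq1.
have : cos (t / 2) ^+ 2 = 1.
  have := cos_mulr2n (t / 2); rewrite -[t / 2 *+ 2]mulr_natr divfK ?pnatr_eq0 // cos_eq1.
  by move=> h; lra.
move=> h; have : sin (t / 2) ^+ 2 = 0 by rewrite sin2cos2 h subrr.
move/eqP; rewrite sqrf_eq0 => /eqP s0.
case: (posnP a) => // a0; have : 0 < sin (t / 2); last by rewrite s0 ltxx.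
apply: sin_gt0_pi; have := @pi_gt0 R => pi0.
have -> : t / 2 = pi * ((nat_of_ord a)%:R / d%:R) :> R.
  by rewrite /t; field; rewrite gt_eqF.
apply/andP; split; first by rewrite mulr_gt0 // divr_gt0 // ltr0n.
by rewrite gtr_pMr // ltr_pdivrMr // mul1r ltr_nat.
Qed.

Lemma sum_chi a : \sum_(k : 'Z_d) chi (k * a) = d%:R *+ (a == 0).
Proof.
case: eqVneq => [->|a0].
  rewrite (eq_bigr (fun=> 1)) => [|k _]; last by rewrite mulr0 chi0.
  by rewrite sumr_const card_ord Zp_cast.
(* Shifting k by 1 multiplies the sum by [chi a], which differs from 1. *)
have : (chi a - 1) * \sum_(k : 'Z_d) chi (k * a) = 0.
  rewrite mulrBl mul1r [X in _ - X](reindex_inj (addIr 1)) /= mulr_sumr.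
  by rewrite -sumrB big1 // => k _; rewrite mulrDl mul1r chiD mulrC subrr.
by move/eqP; rewrite mulf_eq0 subr_eq0 chi_eq1 (negPf a0) /= => /eqP.
Qed.

Lemma norm_weyl_phase p q : `|weyl_phase p q| = 1.
Proof.
rewrite /Defs.weyl_phase; case: eqP => _; last exact: norm_chi.
by rewrite normfV normrX normCi expr1n invr1.
Qed.

Lemma weyl_phase_neq0 p q : weyl_phase p q != 0.
Proof. by rewrite -normr_gt0 norm_weyl_phase. Qed.

Lemma weyl_phase00 : weyl_phase 0 0 = 1.
Proof.
by rewrite /Defs.weyl_phase; case: eqP => _; rewrite ?mul0n ?expr0 ?invr1 // mulr0 oppr0 chi0.
Qed.

End Characters.

(** This normalization makes the adjoint of w(p,q) exactly w(-p,-q). For odd d, 2^-1 pq - pq = -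
    2^-1 pq; for d = 2 the four pairs are checked, and only p = q = 1 is not trivial. *)
Lemma conj_weyl_phase (R : realType) (d : nat) (p q : 'Z_d) : prime d ->
  (weyl_phase R p q)^*%R * chi R (- (p * q)) = weyl_phase R (- p) (- q).
Proof.
move=> d_pr; have d_gt1 := prime_gt1 d_pr; rewrite /Defs.weyl_phase.
case: (eqVneq d 2%N) => [d2|d_neq2]; last first.
  have h2 : (2%:R : 'Z_d)^-1 * 2%:R = 1.
    rewrite mulVr // unitZpE // prime_coprime //.
    by rewrite gtnNdvd // ltn_neqAle eq_sym d_neq2.
  rewrite conj_chi // -chiD //; congr chi; move: h2; set h := _^-1 => h2.
  have -> : p * q = (h * 2%:R) * (p * q) by rewrite h2 mul1r.
  by ring.
move: d_gt1 p q {d_pr}; rewrite d2 => gt1 p q.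
have Z2 (a : 'Z_2) : a = 0 \/ a = 1.
  by case: a => [[|[|//]]] lt_a; [left|right]; apply: val_inj.
have [->|->] := Z2 p.
  by rewrite oppr0 !mul0n expr0 invr1 rmorph1 mul0r oppr0 (chi0 R 2) mulr1.
have [->|->] := Z2 q.
  by rewrite oppr0 !muln0 expr0 invr1 rmorph1 mulr0 oppr0 (chi0 R 2) mulr1.
have N1 : -1 = 1 :> 'Z_2 by apply: val_inj.
rewrite mulr1 N1 muln1 expr1.
(* Its square is [chi] of 1 + 1 = 0, and it is not 1 by [chi_eq1]. *)
have -> : chi R (1 : 'Z_2) = -1.
  have : chi R (1 : 'Z_2) ^+ 2 == 1.
    by rewrite expr2 -(chiD R gt1) (_ : 1 + 1 = 0) ?(chi0 R 2) //; apply: val_inj.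
  by rewrite sqrf_eq1 (chi_eq1 R gt1) /= => /eqP.
by rewrite fmorphV /= conjCi invrN mulrN1 opprK.
Qed.

Section Weyl1.
Variables (R : realType) (d : nat).
Hypothesis d_pr : prime d.
Let d_gt1 := prime_gt1 d_pr.
Local Notation chi := (@chi R d).
Local Notation weyl_phase := (@weyl_phase R d).
Local Notation weyl1 := (@weyl1 R d).

(** The phase relating w(p,q) w(p',q') to w(p+p',q+q'); the factor [chi (- (p' * q))] comes from
    moving X^q past Z^p'. *)
Definition weyl1_cocycle (p q p' q' : 'Z_d) : R[i] :=
  weyl_phase p q * weyl_phase p' q' * chi (- (p' * q)) / weyl_phase (p + p') (q + q').

Lemma norm_weyl1_cocycle p q p' q' : `|weyl1_cocycle p q p' q'| = 1.
Proof.
by rewrite /weyl1_cocycle !normrM normfV !norm_weyl_phase norm_chi invr1 !mulr1.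
Qed.

Lemma mul_weyl1 p q p' q' a b :
  \sum_c weyl1 p q a c * weyl1 p' q' c b =
  weyl1_cocycle p q p' q' * weyl1 (p + p') (q + q') a b.
Proof.
rewrite (bigD1 (b + q')) //= big1 ?addr0 => [|c c_neq]; last first.
  by rewrite /Defs.weyl1 (negPf c_neq) mulr0 mul0r mulr0.
rewrite /weyl1_cocycle /Defs.weyl1 eqxx -addrA (addrC q').
case: eqP => [->|_]; last by rewrite !(mulr0, mul0r).
rewrite !mulr1 [RHS]mulrA [_ / _ * _]divfK ?weyl_phase_neq0 // -!mulrA; congr (_ * _).
rewrite mulrCA; congr (_ * _); rewrite -!(chiD R d_gt1); congr chi; ring.
Qed.

Lemma conj_weyl1 p q a b : (weyl1 p q b a)^*%R = weyl1 (- p) (- q) a b.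
Proof.
rewrite /Defs.weyl1 !rmorphM rmorph_nat /= (conj_chi R d_gt1).
rewrite -[in RHS]conj_weyl_phase // -subr_eq eq_sym.
case: eqP => [->|_]; last by rewrite !(mulr0, mul0r).
rewrite !mulr1 -!mulrA; congr (_ * _); rewrite -(chiD R d_gt1); congr chi; ring.
Qed.

Lemma trace_weyl1 p q : \sum_a weyl1 p q a a = d%:R *+ ((p == 0) && (q == 0)).
Proof.
rewrite /Defs.weyl1; case: (eqVneq q 0) => [->|q0]; last first.
  rewrite andbF big1 // => a _.
  by rewrite -{1}[a]addr0 (inj_eq (addrI a)) eq_sym (negPf q0) mulr0 mul0r.
under eq_bigr do rewrite addr0 eqxx mulr1 [p * _]mulrC.
rewrite -mulr_sumr (sum_chi R d_gt1) andbT; case: eqP => [->|]; last by rewrite mulr0.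
by rewrite weyl_phase00 mul1r.
Qed.

(* Fourier inversion in p recovers the matrix units from the Weyl operators. *)
Lemma sum_weyl1 q a b i j : a - b = q ->
  \sum_p (weyl_phase p q)^-1 * chi (- (p * a)) * weyl1 p q i j
  = d%:R *+ ((i == a) && (j == b)).
Proof.
move=> <-{q}; under eq_bigr do
  rewrite /Defs.weyl1 mulrC !mulrA -[_ * _^-1]mulrC !mulrA mulVf ?weyl_phase_neq0 // mul1r
    -mulrA -(chiD R d_gt1) -mulrBr.
rewrite -mulr_sumr (sum_chi R d_gt1) subr_eq0.
case: (eqVneq i a) => [->|_] /=; last by rewrite mulr0.
rewrite addrCA eq_sym -subr_eq0 addrAC subrr add0r subr_eq0.
by case: eqP; rewrite ?mul0r ?mul1r.
Qed.

End Weyl1.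

(** * Weyl operators on n qudits *)

Section Weyl.
Variables (R : realType) (d n : nat).
Hypothesis d_pr : prime d.
Let d_gt1 := prime_gt1 d_pr.
Local Notation dim := #|{: cfg d n}|.
Local Notation weyl := (@weyl R d n).
Local Notation charfun := (@charfun R d n).
Implicit Types x y : phsp d n.

Lemma sum_ord_cfg (F : cfg d n -> R[i]) : \sum_(i < dim) F (enum_val i) = \sum_f F f.
Proof.
by rewrite -big_enum_val.
Qed.

(** Distributivity over the qudits: this reduces products, traces and Fourier sums on n qudits to
    one qudit. *)
Lemma sum_prod_cfg (F : 'I_n -> 'Z_d -> R[i]) :
  \sum_(f : cfg d n) \prod_k F k (f k) = \prod_k \sum_a F k a.
Proof. by rewrite bigA_distr_bigA. Qed.

Lemma dim_cfg : dim = (d ^ n)%N.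
Proof. by rewrite card_ffun !card_ord Zp_cast. Qed.

Lemma dim_gt0 : (0 < dim)%N.
Proof. by rewrite dim_cfg expn_gt0 ltnW. Qed.

Definition weyl_cocycle x y : R[i] :=
  \prod_k weyl1_cocycle R (x.1 k) (x.2 k) (y.1 k) (y.2 k).

Lemma norm_weyl_cocycle x y : `|weyl_cocycle x y| = 1.
Proof.
by rewrite /weyl_cocycle normr_prod big1 // => k _; rewrite norm_weyl1_cocycle.
Qed.

Lemma mul_weyl x y : weyl x *m weyl y = weyl_cocycle x y *: weyl (x + y).
Proof.
apply/matrixP => i j; rewrite !mxE.
under eq_bigr do rewrite !mxE -big_split /=.
rewrite (sum_ord_cfg (fun f => \prod_(k < n) (weyl1 R (x.1 k) (x.2 k) 
  ((enum_val i : cfg d n) k) (f k) *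
  weyl1 R (y.1 k) (y.2 k) (f k) ((enum_val j : cfg d n) k)))).
rewrite (sum_prod_cfg (fun k a => weyl1 R (x.1 k) (x.2 k) ((enum_val i : cfg d n) k) a *
  weyl1 R (y.1 k) (y.2 k) a ((enum_val j : cfg d n) k))).
by rewrite -big_split; apply: eq_bigr => k _; rewrite mul_weyl1 // !ffunE.
Qed.

Lemma adj_weyl x : (weyl x)^t* = weyl (- x).
Proof.
apply/matrixP => i j; rewrite !mxE rmorph_prod; apply: eq_bigr => k _.
by rewrite /= conj_weyl1 // !ffunE.
Qed.

Lemma eq0_phsp x : (x == 0) = [forall k, (x.1 k == 0) && (x.2 k == 0)].
Proof.
apply/eqP/forallP => [-> k|x0]; first by rewrite !ffunE eqxx.
case: x x0 => p q /= x0; congr (_, _); apply/ffunP => k; rewrite !ffunE;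
  by have /andP[/eqP xk1 /eqP xk2] := x0 k; rewrite ?xk1 ?xk2.
Qed.

Lemma trace_weyl x : \tr (weyl x) = dim%:R *+ (x == 0).
Proof.
rewrite /mxtrace; under eq_bigr do rewrite mxE.
rewrite (sum_ord_cfg (fun f => \prod_(k < n) weyl1 R (x.1 k) (x.2 k) (f k) (f k))).
rewrite (sum_prod_cfg (fun k a => weyl1 R (x.1 k) (x.2 k) a a)).
under eq_bigr do rewrite trace_weyl1 //.
rewrite eq0_phsp; case: forallP => [x0|/forallP]; last first.
  by case/forallPn => k /negPf xk; rewrite (bigD1 k) //= xk mul0r.
under eq_bigr do rewrite x0; rewrite prodr_const card_ord.
by rewrite !mulr1n dim_cfg natrX.
Qed.

Lemma weyl0 : weyl 0 = 1%:M.
Proof.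
apply/matrixP => i j; rewrite !mxE.
under eq_bigr do rewrite !ffunE /weyl1 weyl_phase00 mul1r addr0 mul0r chi0 mulr1.
case: eqP => [->|ij]; first by rewrite big1 // => k _; rewrite eqxx.
have /eqfunP/forallPn[k] : ~ (enum_val i : cfg d n) =1 enum_val j.
  by move=> e; apply: ij; apply: enum_val_inj; apply/ffunP.
by move=> /negPf ek; rewrite (bigD1 k) //= ek mul0r.
Qed.

(** The scalar has modulus 1, and it is a diagonal entry of w(x) times its adjoint, hence
    nonnegative. *)
Lemma weyl_cocycleN x : weyl_cocycle x (- x) = 1.
Proof.
have i0 : 'I_dim by exact: Ordinal dim_gt0.
have E : weyl x *m (weyl x)^t* = weyl_cocycle x (- x) *: 1%:M.
  by rewrite adj_weyl mul_weyl subrr weyl0.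
have c0 : 0 <= weyl_cocycle x (- x).
  move/matrixP/(_ i0 i0): E; rewrite !mxE eqxx mulr1 => <-.
  by apply: sumr_ge0 => j _; rewrite !mxE -normCK exprn_ge0.
by rewrite -(ger0_norm c0) norm_weyl_cocycle.
Qed.

Lemma weylNK x : weyl (- x) *m weyl x = 1%:M.
Proof. by rewrite -{2}[x]opprK mul_weyl weyl_cocycleN scale1r subrr weyl0. Qed.

Lemma weylKN x : weyl x *m weyl (- x) = 1%:M.
Proof. by rewrite mul_weyl weyl_cocycleN scale1r subrr weyl0. Qed.

Lemma trace_mul_weyl x y : \tr (weyl x *m weyl (- y)) = dim%:R *+ (x == y).
Proof.
rewrite mul_weyl mxtraceZ trace_weyl subr_eq0.
by case: eqP => [->|]; rewrite ?weyl_cocycleN ?mul1r ?mulr0.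
Qed.

(** Tensor product of the one-qudit Fourier inversions [sum_weyl1]. The shift q is the difference of
    the two basis labels, so only p is summed. *)
Lemma weyl_delta_mx (i j : 'I_dim) : exists c : cfg d n -> R[i], exists q,
  dim%:R *: delta_mx i j = \sum_p c p *: weyl (p, q).
Proof.
pose a : cfg d n := enum_val i; pose b : cfg d n := enum_val j.
exists (fun p => \prod_k ((weyl_phase R (p k) ((a - b) k))^-1 * chi R (- (p k * a k)))).
exists (a - b); apply/matrixP => s t; rewrite summxE.
under eq_bigr do rewrite !mxE -big_split /=.
rewrite (sum_prod_cfg (fun k p => (weyl_phase R p ((a - b) k))^-1 * chi R (- (p * a k)) *
  weyl1 R p ((a - b) k) ((enum_val s : cfg d n) k) ((enum_val t : cfg d n) k))).
under eq_bigr => k _ do rewrite (@sum_weyl1 _ _ d_pr _ (a k) (b k)) ?ffunE //.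
rewrite !mxE; have [->|si] := eqVneq s i; last first.
  rewrite mulr0; have /eqfunP/forallPn[k] : ~ (enum_val s : cfg d n) =1 a.
    by move=> e; move/eqP: si; apply; apply: enum_val_inj; apply/ffunP.
  by move=> /negPf ek; rewrite (bigD1 k) //= ek mul0r.
have [->|tj] := eqVneq t j; last first.
  rewrite mulr0; have /eqfunP/forallPn[k] : ~ (enum_val t : cfg d n) =1 b.
    by move=> e; move/eqP: tj; apply; apply: enum_val_inj; apply/ffunP.
  by move=> /negPf ek; rewrite (bigD1 k) //= ek andbF mul0r.
under eq_bigr do rewrite !eqxx; rewrite prodr_const card_ord.
by rewrite mulr1n mulr1 dim_cfg natrX.
Qed.

(** The Weyl operators span the matrix units, and the trace of C against a matrix unit is an entry
    of C. *)
Lemma charfun_inj (A B : op R d n) : (forall x, charfun A x = charfun B x) -> A = B.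
Proof.
move=> AB; apply/eqP; rewrite -subr_eq0; apply/eqP.
have C0 x : \tr ((A - B) *m weyl x) = 0.
  by rewrite -(opprK x) mulmxBl raddfB /= [X in X - _]AB subrr.
move: (A - B) C0 => C C0; apply/matrixP => i j; rewrite mxE.
have [c [q E]] := weyl_delta_mx j i.
have : \tr (C *m (dim%:R *: delta_mx j i)) = 0.
  rewrite E mulmx_sumr raddf_sum big1 // => p _ /=.
  by rewrite -scalemxAr mxtraceZ C0 mulr0.
rewrite -scalemxAr mxtraceZ => /eqP; rewrite mulf_eq0 pnatr_eq0 -leqn0 leqNgt dim_gt0 /=.
rewrite /mxtrace (bigD1 i) //= big1 ?addr0 => [|k ki]; last first.
  by rewrite mxE big1 // => l _; rewrite !mxE (negPf ki) andbF mulr0.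
rewrite mxE (bigD1 j) //= big1 ?addr0 => [|k kj]; last first.
  by rewrite !mxE (negPf kj) mulr0.
by rewrite !mxE !eqxx mulr1 => /eqP.
Qed.

End Weyl.

(** * Adjoints, spectra and functional calculus *)

Section Adjoint.
Variable C : numClosedFieldType.

Lemma trmxC_mul m n p (A : 'M[C]_(m, n)) (B : 'M_(n, p)) : (A *m B)^t* = B^t* *m A^t*.
Proof. by rewrite trmx_mul map_mxM. Qed.

Lemma trmxC_add m n (A B : 'M[C]_(m, n)) : (A + B)^t* = A^t* + B^t*.
Proof. by rewrite linearD map_mxD. Qed.

Lemma trmxC_sub m n (A B : 'M[C]_(m, n)) : (A - B)^t* = A^t* - B^t*.
Proof. by rewrite linearB map_mxB. Qed.

Lemma trmxC_scale m n c (A : 'M[C]_(m, n)) : (c *: A)^t* = c^*%R *: A^t*.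
Proof. by rewrite linearZ map_mxZ. Qed.

Lemma trmxC1 n : (1%:M : 'M[C]_n)^t* = 1%:M.
Proof. by rewrite trmx1 map_mx1. Qed.

Lemma trmxC_sum m n (I : Type) (r : seq I) (P : pred I) (F : I -> 'M[C]_(m, n)) :
  (\sum_(i <- r | P i) F i)^t* = \sum_(i <- r | P i) (F i)^t*.
Proof. by rewrite linear_sum map_mx_sum. Qed.

Lemma trace_trmxC n (A : 'M[C]_n) : \tr (A^t*) = (\tr A)^*%R.
Proof. by rewrite /mxtrace rmorph_sum; apply: eq_bigr => i _; rewrite !mxE. Qed.

(** The trace is the sum of the squared moduli of the entries of T. *)
Lemma trace_gram_eq0 m n (T : 'M[C]_(m, n)) : \tr (T^t* *m T) = 0 -> T = 0.
Proof.
move=> T0; have ge0 (j : 'I_n) (i : 'I_m) : 0 <= `|T i j| ^+ 2 by rewrite exprn_ge0.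
have : \sum_j \sum_i `|T i j| ^+ 2 = 0.
  rewrite -[RHS]T0; apply: eq_bigr => j _; rewrite !mxE; apply: eq_bigr => i _.
  by rewrite !mxE normCK mulrC.
move=> S0; apply/matrixP => i j; rewrite mxE.
have /psumr_eq0P S1 := S0; have := S1 (fun j _ => sumr_ge0 _ (fun i _ => ge0 j i)) j isT.
move/psumr_eq0P => /(_ (fun i _ => ge0 j i) i isT) /eqP.
by rewrite sqrf_eq0 normr_eq0 => /eqP.
Qed.

(** In a full-rank factorization P = c r, idempotence forces r c to be the identity of size rank P;
    the trace is cyclic. *)
Lemma mxrank_idem n (P : 'M[C]_n) : P *m P = P -> \tr P = (\rank P)%:R.
Proof.
move=> PP; have := mulmx_base P.
move: (row_base_free P) (col_base_full P); move: (row_base P) (col_base P).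
move=> r c r_free c_full cr; have rc : r *m c = 1%:M.
  apply: (row_free_inj r_free); rewrite mul1mx; apply: (row_full_inj c_full).
  by rewrite !mulmxA cr -mulmxA cr PP.
by rewrite -{1}cr mxtrace_mulC rc mxtrace1.
Qed.

Lemma selfadj_normalmx n (A : 'M[C]_n) : A^t* = A -> A \is normalmx.
Proof. by move=> AA; apply/normalmxP; rewrite AA. Qed.

Lemma spectral_decomp n (A : 'M[C]_n) (U := spectralmx A) : A^t* = A ->
  A = U^t* *m diag_mx (spectral_diag A) *m U.
Proof.
move=> AA; rewrite -invmx_unitary ?spectral_unitarymx //.
exact/orthomx_spectralP/selfadj_normalmx.
Qed.

Lemma spectral_diagE n (A : 'M[C]_n) (U := spectralmx A) : A^t* = A ->
  diag_mx (spectral_diag A) = U *m A *m U^t*.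
Proof.
move=> AA; have /unitarymxP UU := spectral_unitarymx A.
by rewrite {2}(spectral_decomp AA) -/U !mulmxA UU mul1mx -mulmxA UU mulmx1.
Qed.

End Adjoint.

(** Both diagonals list the roots of the same characteristic polynomial. A permutation is the best
    possible, since a diagonalization fixes no order of the eigenvalues. *)
Lemma diag_similar_perm_eq (F : fieldType) n (U V : 'M[F]_n) (u v : 'rV[F]_n) :
  U \in unitmx -> V \in unitmx ->
  invmx U *m diag_mx u *m U = invmx V *m diag_mx v *m V ->
  perm_eq [seq u 0 i | i <- index_enum 'I_n] [seq v 0 i | i <- index_enum 'I_n].
Proof.
have cp (W : 'M[F]_n) (w : 'rV_n) : W \in unitmx ->
    char_poly (invmx W *m diag_mx w *m W) =
    \prod_(x <- [seq w 0 i | i <- index_enum 'I_n]) ('X - x%:P).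
  move=> Wu; have -> : \prod_(x <- [seq w 0 i | i <- index_enum 'I_n]) ('X - x%:P) =
      char_poly (diag_mx w).
    rewrite char_poly_trig ?diag_mx_is_trig // big_map.
    by apply: eq_bigr => i _; rewrite mxE eqxx.
  have WW : map_mx polyC (invmx W) *m map_mx polyC W = 1%:M.
    by rewrite -map_mxM mulVmx // map_mx1.
  rewrite /char_poly /char_poly_mx !map_mxM.
  have -> : 'X%:M - map_mx polyC (invmx W) *m map_mx polyC (diag_mx w) *m map_mx polyC W
    = map_mx polyC (invmx W) *m ('X%:M - map_mx polyC (diag_mx w)) *m map_mx polyC W.
    by rewrite mulmxBr mulmxBl scalar_mxC -[X in _ = X - _]mulmxA WW mulmx1.
  rewrite !det_mulmx mulrAC -det_mulmx WW det1 mul1r //.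
by move=> Uu Vu /(congr1 char_poly); rewrite !cp // => /prod_XsubC_eq.
Qed.

Section Spectral.
Variables (R : realType) (d n : nat).
Local Notation dim := #|{: cfg d n}|.
Implicit Types (A P T : op R d n) (f : R -> R).

Lemma conj_real_complex (c : R) : (c%:C)^*%R = c%:C :> R[i].
Proof. by apply: conj_Creal; rewrite complex_real. Qed.

(** The eigenvalue is the quadratic form of A at the adjoint of row i of the diagonalizing
    unitary. *)
Lemma psd_spectral_ge0 A i : psd A -> 0 <= spectral_diag A 0 i.
Proof.
move=> [AA A0]; have := A0 ((row i (spectralmx A))^t*); rewrite trmxCK.
move: (spectral_diagE AA) => /matrixP/(_ i i); rewrite mxE eqxx mulr1n => ->.
by rewrite -row_mul !mxE; under eq_bigr do rewrite !mxE;
  under [X in _ -> 0 <= X]eq_bigr do rewrite !mxE.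
Qed.

Lemma psd_gram A : psd A -> exists T, A = T^t* *m T.
Proof.
move=> psdA; have [AA _] := psdA; pose l := \row_i sqrtC (spectral_diag A 0 i).
exists (diag_mx l *m spectralmx A); rewrite trmxC_mul mulmxA -[_ *m _ *m diag_mx l]mulmxA.
have -> : (diag_mx l)^t* *m diag_mx l = diag_mx (spectral_diag A).
  rewrite tr_diag_mx map_diag_mx mulmx_diag; congr diag_mx; apply/rowP => i.
  by rewrite !mxE mulrC -normCK -normrX sqrtCK ger0_norm // psd_spectral_ge0.
exact: spectral_decomp.
Qed.

Lemma gram_psd T : psd (T^t* *m T).
Proof.
split; first by rewrite trmxC_mul trmxCK.
move=> v; rewrite mulmxA -trmxC_mul -mulmxA mxE; apply: sumr_ge0 => i _.
by rewrite !mxE mulrC -normCK exprn_ge0.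
Qed.

(** For A = T^* T the trace is the squared Hilbert-Schmidt norm of T B^*. *)
Lemma psd_trace_eq0 A (B : op R d n) : psd A -> \tr (B *m A *m B^t*) = 0 -> B *m A = 0.
Proof.
case/psd_gram => T ->; have E : (T *m B^t*)^t* = B *m T^t* by rewrite trmxC_mul trmxCK.
rewrite !mulmxA -E -mulmxA => /trace_gram_eq0 ->.
by rewrite trmx0 map_mx0 mul0mx.
Qed.

Lemma psd_spectral_Re A i : psd A ->
  spectral_diag A 0 i = (complex.Re (spectral_diag A 0 i))%:C.
Proof. by move=> /psd_spectral_ge0 A0; rewrite RRe_real // ger0_real. Qed.

Lemma psd_Re_ge0 A i : psd A -> 0 <= complex.Re (spectral_diag A 0 i).
Proof. by move=> psdA; rewrite -lecR -psd_spectral_Re // psd_spectral_ge0. Qed.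

Lemma trace_spectral A : A^t* = A -> \tr A = \sum_i spectral_diag A 0 i.
Proof.
move=> AA; rewrite {1}(spectral_decomp AA) -mulmxA mxtrace_mulC -mulmxA.
by rewrite (unitarymxP (spectral_unitarymx A)) mulmx1 mxtrace_diag.
Qed.

Lemma reTr_mxfun f A : reTr (mxfun f A) = \sum_i f (complex.Re (spectral_diag A 0 i)).
Proof.
rewrite /reTr /mxfun -mulmxA mxtrace_mulC mulmxK ?spectral_unit // mxtrace_diag.
by under eq_bigr do rewrite mxE; rewrite -rmorph_sum.
Qed.

Lemma spectral_scaled_proj A (c : R) i : A^t* = A -> A *m A = c%:C *: A ->
  spectral_diag A 0 i = 0 \/ spectral_diag A 0 i = c%:C.
Proof.
move=> AA A2; pose U := spectralmx A; pose l := spectral_diag A.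
have UU : U *m U^t* = 1%:M by apply/unitarymxP/spectral_unitarymx.
have : diag_mx l *m diag_mx l = c%:C *: diag_mx l.
  rewrite spectral_diagE // -/U !mulmxA -[_ *m U^t* *m U]mulmxA.
  rewrite (mulmx1C UU) mulmx1 -[U *m A *m A]mulmxA A2.
  by rewrite -scalemxAr -scalemxAl.
rewrite mulmx_diag => /matrixP/(_ i i); rewrite !mxE eqxx !mulr1n => /eqP.
by rewrite -subr_eq0 -mulrBl mulf_eq0 subr_eq0 => /orP[/eqP|/eqP]; [right|left].
Qed.

(* On the spectrum [{0, c}] every function is affine. *)
Lemma mxfun_scaled_proj f A (c : R) : c != 0 -> A^t* = A -> A *m A = c%:C *: A ->
  mxfun f A = (f 0)%:C *: 1%:M + ((f c - f 0) / c)%:C *: A.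
Proof.
move=> c0 AA A2; pose U := spectralmx A; pose l := spectral_diag A.
have E : map_mx (fun z : R[i] => (f (complex.Re z))%:C) l =
    (f 0)%:C *: const_mx 1 + ((f c - f 0) / c)%:C *: l.
  apply/rowP => i; rewrite !mxE; case: (spectral_scaled_proj i AA A2) => ->;
    first by rewrite mulr0 addr0 mulr1.
  by rewrite /= mulr1 -rmorphM -rmorphD /= divfK // addrC subrK.
rewrite /mxfun -/U -/l E linearD !linearZ /= diag_const_mx mulmxDr mulmxDl.
rewrite -!scalemxAr -!scalemxAl mulmx1 mulVmx ?spectral_unit //; congr (_ + _ *: _).
by apply/esym/orthomx_spectralP/selfadj_normalmx.
Qed.

(** Two diagonalizations of cA agree up to order. A general commutative law covers both the sum in a
    trace and the maximum in [lambda_max]. *)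
Lemma big_spectral_scale (T : Type) (idx : T) (op : SemiGroup.com_law T) (F : R[i] -> T) A c :
  A^t* = A ->
  \big[op/idx]_i F (spectral_diag (c%:C *: A) 0 i) = \big[op/idx]_i F (c%:C * spectral_diag A 0 i).
Proof.
move=> AA; have cA : (c%:C *: A)^t* = c%:C *: A by rewrite trmxC_scale AA conj_real_complex.
have E : invmx (spectralmx (c%:C *: A)) *m diag_mx (spectral_diag (c%:C *: A)) *m
    spectralmx (c%:C *: A) =
    invmx (spectralmx A) *m diag_mx (c%:C *: spectral_diag A) *m spectralmx A.
  rewrite linearZ /= -scalemxAr -scalemxAl.
  have /orthomx_spectralP <- := selfadj_normalmx cA.
  by have /orthomx_spectralP <- := selfadj_normalmx AA.
have := diag_similar_perm_eq (spectral_unit _) (spectral_unit _) E.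
move/(perm_big _ (op := op)) => /(_ idx xpredT F); rewrite !big_map => ->.
by apply: eq_bigr => i _; rewrite mxE.
Qed.

End Spectral.

(** * Stabilizer projections *)

(** The restrictions to the row space of V still commute, so they share an eigenvector, which
    [row_base V] carries back. *)
Lemma common_eigenvector_sub (C : numClosedFieldType) n (V : 'M[C]_n) (As : seq 'M[C]_n) :
  V != 0 -> {in As &, forall A B, comm_mx A B} -> {in As, forall A, stablemx V A} ->
  exists v : 'rV_n, [/\ v != 0, (v <= V)%MS & {in As, forall A, stablemx v A}].
Proof.
move=> V0 As_comm V_stable.
have [] := @common_eigenvector _ _ [seq restrictmx V B | B <- As].
- by rewrite lt0n mxrank_eq0.
- move=> _ _ /mapP[/= B B_in ->] /mapP[/= B' B'_in ->]; rewrite /comm_mx.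
  by rewrite -?conjmxM ?inE ?stablemx_row_base ?V_stable // As_comm.
move=> v vN0 /allP /= vP; exists (v *m row_base V); split.
- by rewrite mulmx_free_eq0 ?row_base_free.
- by rewrite mulmx_sub // eq_row_base.
move=> B B_in; rewrite -stablemx_restrict ?vP ?V_stable //.
by apply/mapP; exists B.
Qed.

Section Stabilizer.
Variables (R : realType) (d n : nat).
Hypothesis d_pr : prime d.
Local Notation dim := #|{: cfg d n}|.
Local Notation weyl := (@weyl R d n).
Local Notation op := (op R d n).
Local Notation gen_alg := (@gen_alg R d n).
Local Notation abelian_weyl_group := (@abelian_weyl_group R d n).
Implicit Types (x y : phsp d n) (S : {set phsp d n}) (lam : phsp d n -> R[i]).

(** Translation by x is an injection of the finite set S into itself, hence onto, so it reaches
    0. *)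
Lemma weyl_group_opp S x : abelian_weyl_group S -> x \in S -> - x \in S.
Proof.
case=> S0 SD _ xS; have : (+%R x) @: S == S.
  rewrite eqEcard (card_imset _ (addrI x)) leqnn andbT.
  by apply/fintype.subsetP => _ /imsetP[y yS ->]; apply: SD.
move/eqP/finset.setP/(_ 0); rewrite S0 => /imsetP[y yS /esym/eqP].
by rewrite addrC addr_eq0 => /eqP <-.
Qed.

Lemma weyl_group_add S x y : abelian_weyl_group S -> x \in S -> (x + y \in S) = (y \in S).
Proof.
move=> Sab xS; have [_ SD _] := Sab; apply/idP/idP => yS; last exact: SD.
by rewrite -[y](addKr x) SD // weyl_group_opp.
Qed.

(** The free width m covers eigenvectors, states and projections alike. *)
Definition weyl_eigen S lam m (B : 'M[R[i]]_(dim, m)) : Prop :=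
  forall x, x \in S -> weyl x *m B = lam x *: B.

(* The projection onto the joint eigenspace with eigenvalues [lam]. *)
Definition stab_proj S lam : op :=
  (#|S|%:R)^-1 *: \sum_(x in S) (lam x)^*%R *: weyl x.

(** * The projection determined by a nonzero joint eigenmatrix *)

Section Joint.
Variables (S : {set phsp d n}) (lam : phsp d n -> R[i]) (m : nat) (B : 'M[R[i]]_(dim, m)).
Hypotheses (Sab : abelian_weyl_group S) (B0 : B != 0) (SB : weyl_eigen S lam B).
Local Notation E := (stab_proj S lam).

Lemma weyl_eigen_scale_inj (a b : R[i]) : a *: B = b *: B -> a = b.
Proof.
move/eqP; rewrite -subr_eq0 -scalerBl scaler_eq0 (negPf B0) orbF subr_eq0.
by move/eqP.
Qed.

Lemma card_weyl_group_neq0 : #|S|%:R != 0 :> R[i].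
Proof. by case: Sab => S0 _ _; rewrite pnatr_eq0 -lt0n; apply/card_gt0P; exists 0. Qed.

Lemma weyl_eigen0 : lam 0 = 1.
Proof.
apply: weyl_eigen_scale_inj; case: Sab => S0 _ _.
by rewrite -SB // weyl0 // mul1mx scale1r.
Qed.

Lemma weyl_eigenD x y : x \in S -> y \in S -> weyl_cocycle R x y * lam (x + y) = lam x * lam y.
Proof.
move=> xS yS; have [_ SD _] := Sab; apply: weyl_eigen_scale_inj.
by rewrite -scalerA -SB ?SD // scalemxAl -mul_weyl // -mulmxA SB // -scalemxAr SB // scalerA mulrC.
Qed.

(** The values at x and -x are inverse to each other, and unitarity of w(x) preserves the nonzero
    Gram matrix of B, which forces modulus 1. *)
Lemma weyl_eigenN x : x \in S -> lam (- x) = (lam x)^*%R.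
Proof.
move=> xS; have NxS := weyl_group_opp Sab xS.
have /eqP := weyl_eigenD xS NxS; rewrite weyl_cocycleN // subrr weyl_eigen0 mulr1.
move=> /eqP/esym lamVN.
have lam0 : lam x != 0 by apply: contra_eq_neq lamVN => ->; rewrite mul0r eq_sym oner_eq0.
apply: (mulfI lam0); rewrite lamVN -normCK.
have norm2 : (lam x * (lam x)^*%R) *: (B^t* *m B) = B^t* *m B.
  transitivity ((weyl x *m B)^t* *m (weyl x *m B)).
    by rewrite SB // trmxC_scale -scalemxAl -scalemxAr scalerA mulrC.
  by rewrite trmxC_mul adj_weyl // -mulmxA [weyl (-x) *m _]mulmxA weylNK // mul1mx.
have BB0 : B^t* *m B != 0.
  apply: contra_neq B0 => BB; apply: trace_gram_eq0; by rewrite BB mxtrace0.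
move/eqP: norm2; rewrite -normCK -subr_eq0 -{2}[_ *m B]scale1r -scalerBl scaler_eq0.
by rewrite (negPf BB0) orbF subr_eq0 => /eqP.
Qed.

Lemma norm_weyl_eigen x : x \in S -> `|lam x| = 1.
Proof.
move=> xS; have := weyl_eigenD xS (weyl_group_opp Sab xS).
rewrite weyl_cocycleN // subrr weyl_eigen0 weyl_eigenN // -normCK mulr1.
by move/esym/eqP; rewrite sqrp_eq1 // => /eqP.
Qed.

Lemma stab_proj_fix k (A : 'M[R[i]]_(dim, k)) : weyl_eigen S lam A -> E *m A = A.
Proof.
move=> SA; rewrite /stab_proj -scalemxAl mulmx_suml (eq_bigr (fun=> A)) => [|x xS]; last first.
  by rewrite -scalemxAl SA // scalerA mulrC -normCK norm_weyl_eigen // expr1n scale1r.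
by rewrite sumr_const -[A *+ _]scaler_nat scalerA mulVf ?scale1r // card_weyl_group_neq0.
Qed.

(** Multiplication by w(x) translates the sum over S; the twisted multiplicativity [weyl_eigenD]
    turns the cocycle into the factor [lam x]. *)
Lemma stab_proj_eigen : weyl_eigen S lam E.
Proof.
move=> x xS; rewrite /stab_proj -scalemxAr scalerA mulrC -scalerA; congr (_ *: _).
rewrite mulmx_sumr scaler_sumr [RHS](reindex_inj (addrI x)) /=.
apply: eq_big => [y|y yS]; first by rewrite weyl_group_add.
have [_ SD _] := Sab; have := weyl_eigenD xS yS => cD.
rewrite -scalemxAr mul_weyl // !scalerA; congr (_ *: _).
have normL z : z \in S -> lam z * (lam z)^*%R = 1.
  by move=> zS; rewrite -normCK norm_weyl_eigen // expr1n.
transitivity ((lam y)^*%R * (weyl_cocycle R x y * lam (x + y)) * (lam (x + y))^*%R).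
  by rewrite -!mulrA normL ?SD // mulr1.
by rewrite cD mulrCA [(lam y)^*%R * _]mulrC normL // mulr1.
Qed.

Lemma stab_proj_idem : E *m E = E.
Proof. exact/stab_proj_fix/stab_proj_eigen. Qed.

Lemma adj_stab_proj : E^t* = E.
Proof.
rewrite /stab_proj trmxC_scale fmorphV /= conjC_nat trmxC_sum; congr (_ *: _).
have oppI : injective (fun x : phsp d n => - x) := @oppr_inj _.
rewrite [RHS](reindex_inj oppI) /=; apply: eq_big => x.
  by apply/idP/idP => /(weyl_group_opp Sab) //; rewrite opprK.
by move=> xS; rewrite trmxC_scale adj_weyl // weyl_eigenN.
Qed.

Lemma stab_proj_neq0 : E <> 0.
Proof. by move=> E0; move/eqP: B0; apply; rewrite -(stab_proj_fix SB) E0 mul0mx. Qed.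

Lemma stab_proj_gen : gen_alg S E.
Proof.
move=> P PS PD PZ PM PA; apply: (PZ); case: Sab => S0 _ _.
have P0 : P 0 by rewrite -(scale0r (weyl 0)); apply: PZ; apply: PS.
by elim/big_ind: _ => // x xS; apply: PZ; apply: PS.
Qed.

Lemma gen_alg_stab_proj A : gen_alg S A -> exists c, A *m E = c *: E.
Proof.
have EW := stab_proj_eigen.
(* The adjoint is included so that the induction passes the closure under adjoints. *)
move=> SA; suff [c []] : exists c, A *m E = c *: E /\ A^t* *m E = c^*%R *: E by exists c.
apply: (SA (fun A => exists c, A *m E = c *: E /\ A^t* *m E = c^*%R *: E))
  => [x xS|A1 A2|c A1|A1 A2|A1].
- exists (lam x); split; first exact: EW.
  by rewrite adj_weyl // EW ?weyl_group_opp // weyl_eigenN.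
- move=> [c [E1 E1']] [c' [E2 E2']]; exists (c + c').
  by rewrite trmxC_add !mulmxDl E1 E2 E1' E2' rmorphD !scalerDl.
- move=> [c' [E1 E1']]; exists (c * c').
  by rewrite trmxC_scale -!scalemxAl E1 E1' !scalerA rmorphM.
- move=> [c [E1 E1']] [c' [E2 E2']]; exists (c * c').
  split; first by rewrite -mulmxA E2 -scalemxAr E1 scalerA mulrC.
  by rewrite trmxC_mul -mulmxA E1' -scalemxAr E2' scalerA rmorphM.
- by move=> [c [E1 E1']]; exists (c^*%R); rewrite trmxCK conjCK.
Qed.

(** A acts on E as a scalar c, and idempotence gives c^2 = c, so c is 0 or 1. *)
Lemma stab_proj_absorb A : gen_alg S A -> is_proj A -> A *m E <> 0 -> A *m E = E.
Proof.
move=> SA [AA _] AE0; have [c Ec] := gen_alg_stab_proj SA.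
have : (c * c) *: E = c *: E by rewrite -scalerA -Ec scalemxAr -Ec mulmxA AA.
move/eqP; rewrite -subr_eq0 -scalerBl scaler_eq0 => /orP[|/eqP/stab_proj_neq0//].
rewrite -{3}[c]mulr1 -mulrBr mulf_eq0 subr_eq0 => /orP[/eqP c0|/eqP c1].
  by case: AE0; rewrite Ec c0 scale0r.
by rewrite Ec c1 scale1r.
Qed.

Lemma stab_proj_min : min_proj S E.
Proof.
split; [exact: stab_proj_gen| |exact: stab_proj_neq0|].
  by split; [exact: stab_proj_idem|exact: adj_stab_proj].
move=> Q SQ Qp Q0 QE; rewrite -QE; apply: stab_proj_absorb => //.
by rewrite QE.
Qed.

(** The rank is the trace, to which only the term x = 0 contributes. *)
Lemma rank_stab_proj : (\rank E * #|S| = dim)%N.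
Proof.
apply/eqP; rewrite -(eqr_nat R[i]) natrM -mxrank_idem ?stab_proj_idem //.
rewrite /stab_proj mxtraceZ raddf_sum (bigD1 (0 : phsp d n)) /=; last by case: Sab.
rewrite big1 ?addr0 => [|x /andP[xS x0]]; last first.
  by rewrite mxtraceZ trace_weyl // (negPf x0) mulr0.
rewrite mxtraceZ trace_weyl // eqxx weyl_eigen0 rmorph1 mul1r mulrC mulrA.
by rewrite divff ?mul1r // card_weyl_group_neq0.
Qed.

End Joint.

Lemma gen_alg_comm S A x : abelian_weyl_group S -> gen_alg S A -> x \in S ->
  A *m weyl x = weyl x *m A.
Proof.
move=> Sab SA xS; have [_ _ SC] := Sab.
(* All of S is quantified at once because the adjoint case at y uses commutation with w(-y). *)
suff : forall y, y \in S -> A *m weyl y = weyl y *m A by apply.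
apply: (SA (fun A => forall y, y \in S -> A *m weyl y = weyl y *m A))
  => [z zS y yS|A1 A2 H1 H2 y yS|c A1 H1 y yS|A1 A2 H1 H2 y yS|A1 H1 y yS].
- exact: SC.
- by rewrite mulmxDl mulmxDr H1 ?H2.
- by rewrite -scalemxAl H1 // scalemxAr.
- by rewrite -mulmxA H2 // mulmxA H1 // mulmxA.
- have /(congr1 (fun M : op => M^t*)) := H1 _ (weyl_group_opp Sab yS).
  by rewrite !trmxC_mul !adj_weyl // opprK.
Qed.

(* A joint eigenvector in the range of P determines a projection below P,
   which is P by minimality. *)
Lemma min_proj_stab S (P : op) : abelian_weyl_group S -> min_proj S P ->
  exists lam (v : 'cV[R[i]]_dim), [/\ v != 0, weyl_eigen S lam v & P = stab_proj S lam].
Proof.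
move=> Sab [SP [PP PA] P0 Pmin].
have Pcomm x : x \in S -> P *m weyl x = weyl x *m P := gen_alg_comm Sab SP.
have [||/= A|v [v0 vP vS]] := @common_eigenvector_sub _ _ P [seq weyl x | x in S].
- exact/eqP.
- by move=> _ _ /fintype.imageP[x xS ->] /fintype.imageP[y yS ->]; case: Sab => _ _; apply.
- by move=> /fintype.imageP[x xS ->]; rewrite Pcomm // submxMl.
have vPv : v *m P = v by case/submxP: vP => u ->; rewrite -mulmxA PP.
have eigenv (x : phsp d n) : exists a : R[i], x \in S -> v *m weyl x = a *: v.
  have [xS|] := boolP (x \in S); last by exists 0.
  by have /sub_rVP[a ->] := vS _ (fintype.image_f _ xS); exists a.
have [a aE] := boolp.choice eigenv.
(* v is a row eigenvector; the adjoint of v w(-x) = a(-x) v is a column equation for w(x). *)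
pose lam x := (a (- x))^*%R; have Ev : weyl_eigen S lam (v^t*).
  move=> x xS; rewrite -[weyl x]trmxCK adj_weyl // -trmxC_mul aE ?weyl_group_opp //.
  by rewrite trmxC_scale.
have v0' : v^t* != 0.
  by apply: contra_neq v0 => v0'; rewrite -[v]trmxCK v0' trmx0 map_mx0.
exists lam, (v^t*); split=> //; set E := stab_proj S lam.
have Pv : P *m v^t* = v^t* by rewrite -{1}PA -trmxC_mul vPv.
have PE : P *m E = E.
  apply: (stab_proj_absorb Sab v0' Ev) => // PE0.
  have /eqP := v0'; apply; rewrite -Pv -(stab_proj_fix Sab v0' Ev Ev) mulmxA.
  by rewrite PE0 mul0mx.
have EA : E^t* = E := adj_stab_proj Sab v0' Ev.
(* E is a nonzero projection of the algebra, and the adjoint of P E = E places it below P. *)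
symmetry; apply: Pmin; [exact: (stab_proj_gen lam Sab)| |exact: (stab_proj_neq0 Sab v0' Ev)|].
  by split=> //; exact: (stab_proj_idem Sab v0' Ev).
by rewrite -{1}EA -{1}PA -trmxC_mul PE EA.
Qed.

End Stabilizer.

(** * Entropies of normalized projections *)

Section States.
Variables (R : realType) (d n : nat).
Local Notation dim := #|{: cfg d n}|.
Local Notation op := (op R d n).
Implicit Types (rho sigma P : op) (a k c : R) (alpha : \bar R).

Lemma sum_spectral_Re rho : state rho -> \sum_i complex.Re (spectral_diag rho 0 i) = 1.
Proof.
move=> [psdr tr1]; apply: (@complexI R); rewrite rmorph_sum rmorph1 -tr1.
rewrite trace_spectral; last by case: psdr.
by apply: eq_bigr => i _; apply/esym/psd_spectral_Re.
Qed.

(** Nonnegative eigenvalues with sum 1 cannot all vanish. This keeps traces of powers and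
    [lambda_max] positive under the logarithm. *)
Lemma spectral_Re_gt0 rho : state rho -> exists i, 0 < complex.Re (spectral_diag rho 0 i).
Proof.
move=> st; have [psdr _] := st.
have [i i0|le0] := pickP (fun i => 0 < complex.Re (spectral_diag rho 0 i)); first by exists i.
have := sum_spectral_Re st.
rewrite big1 => [/esym/eqP|i _]; first by rewrite oner_eq0.
by apply/eqP; rewrite eq_le psd_Re_ge0 // andbT leNgt le0.
Qed.

Lemma reTr_mxpow_gt0 a rho : state rho -> 0 < reTr (mxpow a rho).
Proof.
move=> st; have [i i0] := spectral_Re_gt0 st.
rewrite reTr_mxfun (bigD1 i) //= ltr_pwDl ?powR_gt0 //.
by apply: sumr_ge0 => j _; apply: powR_ge0.
Qed.

Lemma reTr_mxpow_scale a k rho : psd rho -> 0 <= k ->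
  reTr (mxpow a (k%:C *: rho)) = k `^ a * reTr (mxpow a rho).
Proof.
move=> psdr k0; have [AA _] := psdr; rewrite !reTr_mxfun.
rewrite (big_spectral_scale _ _ (fun z => complex.Re z `^ a)) // mulr_sumr.
apply: eq_bigr => i _; rewrite psd_spectral_Re // -rmorphM /=.
by rewrite powRM // psd_Re_ge0.
Qed.

Lemma lambda_max_gt0 rho : state rho -> 0 < lambda_max rho.
Proof.
move=> st; have [i i0] := spectral_Re_gt0 st; apply: lt_le_trans i0 _.
exact: (le_bigmax _ (fun i => complex.Re (spectral_diag rho 0 i))).
Qed.

Lemma lambda_max_scale k rho : psd rho -> 0 <= k ->
  lambda_max (k%:C *: rho) = k * lambda_max rho.
Proof.
move=> psdr k0; have [AA _] := psdr; rewrite /lambda_max.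
rewrite (big_spectral_scale _ _ (fun z => complex.Re z)) //.
rewrite (big_morph (fun x => k * x) (fun x y => maxr_pMr x y k0) (mulr0 k)).
by apply: eq_bigr => i _; rewrite psd_spectral_Re // -rmorphM.
Qed.

Section FlatState.
Variable P : op.
Hypotheses (P_proj : is_proj P) (P_neq0 : P <> 0).
Local Notation r := (\rank P).
Local Notation c := ((r%:R : R)^-1).
Local Notation sigma := ((r%:R)^-1 *: P).

Let r_gt0 : 0 < r%:R :> R.
Proof. by rewrite ltr0n lt0n mxrank_eq0; apply/eqP. Qed.

Let c_gt0 : 0 < c. Proof. by rewrite invr_gt0. Qed.

Let sigmaE : sigma = c%:C *: P.
Proof. by rewrite fmorphV rmorph_nat. Qed.

Let sigma_adj : sigma^t* = sigma.
Proof. by case: P_proj => _ PA; rewrite sigmaE trmxC_scale PA conj_real_complex. Qed.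

Let sigma_sq : sigma *m sigma = c%:C *: sigma.
Proof. by case: P_proj => PP _; rewrite sigmaE -scalemxAl -scalemxAr PP. Qed.

(** Applies to nonzero powers and also to [ln], whose value at 0 is 0 by convention: the kernel
    contributes nothing. *)
Let mxfun_sigma f : f 0 = 0 -> mxfun f sigma = (f c)%:C *: P.
Proof.
move=> f0; rewrite (mxfun_scaled_proj f (lt0r_neq0 c_gt0) sigma_adj sigma_sq) f0 subr0.
by rewrite rmorph0 scale0r add0r sigmaE scalerA -rmorphM divfK ?lt0r_neq0.
Qed.

Let ln_c : ln c = - ln r%:R.
Proof. by rewrite lnV. Qed.

Let sigma_state : state sigma.
Proof.
case: P_proj => PP PA; split; last first.
  by rewrite mxtraceZ mxrank_idem // mulVf // pnatr_eq0 -lt0n -(ltr0n R).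
split=> // v; rewrite -scalemxAr -scalemxAl mxE mulr_ge0 ?invr_ge0 ?ler0n //.
have [_] := gram_psd P; rewrite PA PP; apply.
Qed.

Lemma renyi_flat alpha : (1 <= alpha)%E -> renyi alpha sigma = ln r%:R.
Proof.
case: P_proj sigma_state => PP PA [psds tr1].
case: alpha => [a||] //= a1; last first.
  suff -> : lambda_max sigma = c by rewrite ln_c opprK.
  have [i i0] := spectral_Re_gt0 sigma_state.
  apply/le_anti/andP; split.
    apply: bigmax_le => [|j _]; first exact: ltW.
    by case: (spectral_scaled_proj j sigma_adj sigma_sq) => -> //=; exact: ltW.
  case: (spectral_scaled_proj i sigma_adj sigma_sq) => Ei; first by rewrite Ei ltxx in i0.
  have := @le_bigmax _ _ _ 0 (fun i => complex.Re (spectral_diag sigma 0 i)) i.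
  by rewrite Ei.
case: eqVneq => [_|a_neq1].
  rewrite (mxfun_sigma (ln0 (lexx 0))) -scalemxAr -scalemxAl PP /reTr mxtraceZ tr1 mulr1 /=.
  by rewrite ln_c opprK.
have a_neq0 : a != 0 by apply: contraTneq a1 => ->; rewrite lee_fin ler10.
rewrite /mxpow mxfun_sigma ?powR0 // /reTr mxtraceZ mxrank_idem //.
rewrite -(rmorph_nat (real_complex R)) -rmorphM /= lnM ?posrE ?powR_gt0 //.
have d0 : 1 - a != 0 by rewrite subr_eq0 eq_sym.
by rewrite ln_powR ln_c; field.
Qed.

(** The columns of 1 - P lie in the kernel of [sigma], so rho (1 - P) = 0; then take adjoints. *)
Lemma supp_le_flat rho : rho^t* = rho -> supp_le rho sigma -> P *m rho = rho.
Proof.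
case: P_proj => PP PA rA le.
have : rho *m (1%:M - P) = 0.
  have c0 j : col j (rho *m (1%:M - P)) = 0.
    rewrite colE -mulmxA; apply: le.
    by rewrite -scalemxAl mulmxA mulmxBr mulmx1 PP subrr mul0mx scaler0.
  by apply/matrixP => i j; have /matrixP/(_ i 0) := c0 j; rewrite !mxE.
rewrite mulmxBr mulmx1 => /eqP; rewrite subr_eq0 => /eqP E.
by rewrite -{1}rA -PA -trmxC_mul -E.
Qed.

Lemma flat_supp_le rho : rho^t* = rho -> P *m rho = rho -> supp_le rho sigma.
Proof.
case: P_proj => PP PA rA Pr v; rewrite -scalemxAl => /eqP; rewrite scaler_eq0.
rewrite invr_eq0 pnatr_eq0 gtn_eqF -?(ltr0n R) //= => /eqP Pv.
have -> : rho = rho *m P by rewrite -{2}rA -PA -trmxC_mul Pr rA.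
by rewrite -mulmxA Pv mulmx0.
Qed.

(** Sandwiching with sigma^s only scales rho by c^(2s). For finite a > 1, 2s = (1-a)/a, so the trace
    gains c^(1-a), which contributes - ln c = ln r after division by a - 1. At infinity 2s = -1
    gives the factor r directly, and at a = 1 the logarithm of [sigma] acts on rho as ln c. *)
Lemma sandwiched_flat rho alpha : state rho -> P *m rho = rho -> (1 <= alpha)%E ->
  sandwiched alpha rho sigma = (ln r%:R - renyi alpha rho)%:E.
Proof.
case: P_proj => PP PA st Pr; have [psdr tr1] := st; have [rA _] := psdr.
have rP : rho *m P = rho by rewrite -{1}rA -PA -trmxC_mul Pr rA.
rewrite /sandwiched asboolT; last exact: flat_supp_le.
have conj_pow s : s != 0 ->
    mxpow s sigma *m rho *m mxpow s sigma = (c `^ (s *+ 2))%:C *: rho.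
  move=> s0; rewrite /mxpow mxfun_sigma ?powR0 // -scalemxAl -scalemxAr Pr -scalemxAl rP.
  by rewrite scalerA -rmorphM mulr2n powRD // (negPf (lt0r_neq0 c_gt0)) implybT.
case: alpha => [a||] //= a1; congr EFin; last first.
  have h0 : - (2^-1) != 0 :> R by rewrite oppr_eq0 invr_eq0 pnatr_eq0.
  rewrite conj_pow // mulNrn -[2^-1 *+ 2]mulr_natr mulVf ?pnatr_eq0 // powR_inv1 ?ltW //.
  by rewrite invrK lambda_max_scale ?ltW // lnM ?posrE ?lambda_max_gt0 // opprK.
case: eqVneq => [_|a_neq1].
  rewrite (mxfun_sigma (ln0 (lexx 0))) mulmxBr /reTr !raddfB /= -scalemxAr rP mxtraceZ tr1 mulr1.
  by rewrite opprK addrC ln_c /= opprK.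
have a0 : a != 0 by apply: contraTneq a1 => ->; rewrite lee_fin ler10.
have s0 : (1 - a) / (2 * a) != 0.
  by rewrite mulf_neq0 ?invr_eq0 ?mulf_neq0 ?pnatr_eq0 // subr_eq0 eq_sym.
rewrite conj_pow // reTr_mxpow_scale ?powR_ge0 // lnM ?posrE ?powR_gt0 ?reTr_mxpow_gt0 //.
have d0 : a - 1 != 0 by rewrite subr_eq0.
have d0' : 1 - a != 0 by rewrite subr_eq0 eq_sym.
rewrite !ln_powR ln_c; field; by rewrite a0 d0 d0'.
Qed.

Lemma sandwiched_flat_infty rho alpha : state rho -> P *m rho <> rho ->
  sandwiched alpha rho sigma = +oo%E.
Proof.
move=> [[rA _] _] Pr; rewrite /sandwiched asboolF // => le.
by apply: Pr; apply: supp_le_flat.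
Qed.

End FlatState.
End States.

(** * The mean state *)

(** Used with ranks a, b and group orders s, g, whose products both equal [dim]: the larger group
    has the smaller rank. *)
Lemma ltn_cross_mul (a s b g : nat) : (a * s = b * g -> s < g -> 0 < b -> b < a)%N.
Proof.
move=> E sg b0; rewrite ltnNge; apply/negP => le; have := leq_mul le (leqnn s).
by rewrite E leq_pmul2l // leqNgt sg.
Qed.

Lemma ln_ltn (R : realType) (a b : nat) : (0 < a)%N -> (a < b)%N -> ln (a%:R : R) < ln b%:R.
Proof.
by move=> a0 ab; rewrite ltr_ln ?posrE ?ltr0n ?ltr_nat // (ltn_trans a0).
Qed.

Section MeanState.
Variables (R : realType) (d n : nat).
Hypothesis d_pr : prime d.
Local Notation dim := #|{: cfg d n}|.
Local Notation weyl := (@weyl R d n).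
Local Notation op := (op R d n).
Implicit Types (x y : phsp d n) (S : {set phsp d n}) (lam : phsp d n -> R[i]) (rho : op).

Definition stab_state S lam : op :=
  ((\rank (stab_proj S lam))%:R)^-1 *: stab_proj S lam.

Lemma stab_stateE S lam m (B : 'M[R[i]]_(dim, m)) :
  abelian_weyl_group R S -> B != 0 -> weyl_eigen S lam B ->
  stab_state S lam = (dim%:R)^-1 *: \sum_(x in S) (lam x)^*%R *: weyl x.
Proof.
move=> Sab B0 SB; rewrite /stab_state {2}/stab_proj scalerA -invfM -natrM mulnC.
by rewrite mulnC (rank_stab_proj d_pr Sab B0 SB).
Qed.

Lemma charfun_stab_state S lam m (B : 'M[R[i]]_(dim, m)) x :
  abelian_weyl_group R S -> B != 0 -> weyl_eigen S lam B ->
  charfun (stab_state S lam) x = if x \in S then (lam x)^*%R else 0.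
Proof.
move=> Sab B0 SB; rewrite /charfun (stab_stateE Sab B0 SB) -scalemxAl mulmx_suml.
rewrite mxtraceZ raddf_sum /=.
have dim0 : dim%:R != 0 :> R[i] by rewrite pnatr_eq0 -lt0n dim_gt0.
case: ifP => xS; last first.
  rewrite big1 ?mulr0 // => y yS; rewrite -scalemxAl mxtraceZ trace_mul_weyl //.
  by case: eqP => [yx|_]; [rewrite yx xS in yS|rewrite mulr0].
rewrite (bigD1 x) //= big1 ?addr0 => [|y /andP[_ yx]]; last first.
  by rewrite -scalemxAl mxtraceZ trace_mul_weyl // (negPf yx) mulr0.
by rewrite -scalemxAl mxtraceZ trace_mul_weyl // eqxx mulrC -mulrA divff ?mulr1.
Qed.

Lemma MSPS_stab_state (sigma : op) : MSPS sigma -> exists S lam (v : 'cV[R[i]]_dim),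
  [/\ abelian_weyl_group R S, v != 0, weyl_eigen S lam v & sigma = stab_state S lam].
Proof.
case=> S [P [Sab Pmin ->]]; have [lam [v [v0 Sv ->]]] := min_proj_stab d_pr Sab Pmin.
by exists S, lam, v.
Qed.

(* Equality case of |tr (rho U)| <= 1. *)
Lemma unitary_extremal rho (U : op) : state rho -> U^t* *m U = 1%:M ->
  `|\tr (rho *m U)| = 1 -> U *m rho = \tr (rho *m U) *: rho.
Proof.
move=> [psdr tr1] UU; set c := \tr _ => c1; have [rA _] := psdr.
have cc : c * c^*%R = 1 by rewrite -normCK c1 expr1n.
apply/eqP; rewrite -subr_eq0 -mul_scalar_mx -mulmxBl; apply/eqP.
apply: psd_trace_eq0 => //.
(* The trace of (U - c) rho (U - c)^* expands into four terms, 1 - 1 - 1 + 1 = 0. *)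
have E1 : \tr (U *m rho *m U^t*) = 1 by rewrite mxtrace_mulC mulmxA UU mul1mx.
have E2 : \tr (U *m rho) = c by rewrite mxtrace_mulC.
have E3 : \tr (rho *m U^t*) = c^*%R by rewrite -E2 -trace_trmxC trmxC_mul rA.
rewrite trmxC_sub -scalemx1 trmxC_scale trmxC1 mulmxBl !mulmxBr !mulmxBl.
rewrite -!scalemxAl -!scalemxAr !mulmx1 !mul1mx.
rewrite !raddfB /= !mxtraceZ E1 E2 E3 tr1 mulr1 [c^*%R * c]mulrC cc.
by rewrite !subrr addr0.
Qed.

(** * The stabilizer group of a state *)

Section Stabilizer.
Variable rho : op.
Hypothesis st : state rho.

Definition stab_set : {set phsp d n} := [set x | `|charfun rho x| == 1]%SET.
(** The sign undoes the one in [charfun]: this is the expectation of w(x), hence its eigenvalue on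
    rho for x in [stab_set]. *)
Definition stab_val x : R[i] := charfun rho (- x).

Lemma stab_val_trace x : stab_val x = \tr (rho *m weyl x).
Proof. by rewrite /stab_val /charfun opprK. Qed.

Lemma conj_stab_val x : (stab_val x)^*%R = charfun rho x.
Proof.
have [[rA _] _] := st.
by rewrite stab_val_trace -trace_trmxC trmxC_mul rA adj_weyl // mxtrace_mulC.
Qed.

Lemma mem_stab_set x : (x \in stab_set) = (`|stab_val x| == 1).
Proof. by rewrite inE -conj_stab_val norm_conjC. Qed.

Lemma stab_eigen : weyl_eigen stab_set stab_val rho.
Proof.
move=> x; rewrite mem_stab_set stab_val_trace => /eqP xS.
by apply: unitary_extremal; rewrite // adj_weyl // weylNK.
Qed.

Lemma state_neq0 : rho != 0.
Proof.
have [_ tr1] := st; apply/eqP => r0; move/eqP: tr1.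
by rewrite r0 mxtrace0 eq_sym oner_eq0.
Qed.

Lemma weyl_eigen_stab_val S lam : weyl_eigen S lam rho -> {in S, stab_val =1 lam}.
Proof.
move=> Sr x xS; have [_ tr1] := st.
by rewrite stab_val_trace mxtrace_mulC Sr // mxtraceZ tr1 mulr1.
Qed.

(** On rho, w(x) w(y) acts as a product of two phases, so the expectation of w(x+y) again has
    modulus 1. *)
Lemma stab_set_group : abelian_weyl_group R stab_set.
Proof.
have r0 := state_neq0.
have mulE x y : x \in stab_set -> y \in stab_set ->
    weyl x *m weyl y *m rho = (stab_val x * stab_val y) *: rho.
  by move=> xS yS; rewrite -mulmxA (stab_eigen yS) -scalemxAr (stab_eigen xS) scalerA mulrC.
have valD x y : x \in stab_set -> y \in stab_set ->
    weyl_cocycle R x y * stab_val (x + y) = stab_val x * stab_val y.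
  move=> xS yS; have [_ tr1] := st.
  have /(congr1 mxtrace) := mulE _ _ xS yS.
  rewrite mul_weyl // -scalemxAl !mxtraceZ tr1 mulr1 => <-.
  by rewrite mxtrace_mulC -stab_val_trace.
split.
- by rewrite mem_stab_set stab_val_trace weyl0 // mulmx1; have [_ ->] := st; rewrite normr1.
- move=> x y xS yS; have /(congr1 Num.norm) := valD _ _ xS yS.
  rewrite !normrM norm_weyl_cocycle mul1r mem_stab_set => ->.
  by move: xS yS; rewrite !mem_stab_set => /eqP -> /eqP ->; rewrite mulr1.
(* Both orders give multiples of w(x+y). The two cocycles agree because the scalars on rho commute
   and [stab_val (x + y)] is nonzero. *)
- move=> x y xS yS; rewrite !mul_weyl // [y + x]addrC; congr (_ *: _).
  have E : weyl_cocycle R x y * stab_val (x + y) = weyl_cocycle R y x * stab_val (x + y).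
    by rewrite (valD _ _ xS yS) [x + y]addrC (valD _ _ yS xS) mulrC.
  apply: mulIf E; rewrite -normr_gt0.
  have /(congr1 Num.norm) := valD _ _ xS yS.
  rewrite !normrM norm_weyl_cocycle mul1r => ->.
  by move: xS yS; rewrite !mem_stab_set => /eqP -> /eqP ->; rewrite mulr1.
Qed.

(** The stabilizer state has the prescribed characteristic function, so [xget] returns a genuine
    solution instead of its default 0, and [charfun_inj] makes the solution unique. *)
Lemma mean_stateE : mean_state rho = stab_state stab_set stab_val.
Proof.
have Mchar x : charfun (stab_state stab_set stab_val) x =
    if `|charfun rho x| == 1 then charfun rho x else 0.
  rewrite (charfun_stab_state _ stab_set_group state_neq0 stab_eigen).
  by rewrite inE conj_stab_val.
apply: charfun_inj => // x; rewrite Mchar.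
pose good (M : op) := forall x, charfun M x = if `|charfun rho x| == 1 then charfun rho x else 0.
suff : good (mean_state rho) by apply.
by apply: (@xgetPex _ 0 good); exists (stab_state stab_set stab_val).
Qed.

End Stabilizer.

Lemma stab_state_MSPS S lam m (B : 'M[R[i]]_(dim, m)) :
  abelian_weyl_group R S -> B != 0 -> weyl_eigen S lam B -> MSPS (stab_state S lam).
Proof.
move=> Sab B0 SB; exists S, (stab_proj S lam); split=> //.
exact: (stab_proj_min d_pr Sab B0 SB).
Qed.

Lemma sandwiched_stab_state rho S lam m (B : 'M[R[i]]_(dim, m)) alpha :
  abelian_weyl_group R S -> B != 0 -> weyl_eigen S lam B -> state rho -> (1 <= alpha)%E ->
  weyl_eigen S lam rho ->
  sandwiched alpha rho (stab_state S lam) =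
  (ln (\rank (stab_proj S lam))%:R - renyi alpha rho)%:E.
Proof.
move=> Sab B0 SB st a1 Sr; apply: sandwiched_flat => //.
- by split; [exact: (stab_proj_idem d_pr Sab B0 SB)|exact: (adj_stab_proj d_pr Sab B0 SB)].
- exact: (stab_proj_neq0 d_pr Sab B0 SB).
- exact: (stab_proj_fix d_pr Sab B0 SB).
Qed.

Lemma sandwiched_stab_state_infty rho S lam m (B : 'M[R[i]]_(dim, m)) alpha :
  abelian_weyl_group R S -> B != 0 -> weyl_eigen S lam B -> state rho ->
  ~ weyl_eigen S lam rho -> sandwiched alpha rho (stab_state S lam) = +oo%E.
Proof.
move=> Sab B0 SB st Sr; apply: sandwiched_flat_infty => //.
- by split; [exact: (stab_proj_idem d_pr Sab B0 SB)|exact: (adj_stab_proj d_pr Sab B0 SB)].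
- move=> Er; apply: Sr => x xS.
  by rewrite -{1}Er mulmxA (stab_proj_eigen d_pr Sab B0 SB xS) -scalemxAl Er.
Qed.

Lemma renyi_stab_state S lam m (B : 'M[R[i]]_(dim, m)) alpha :
  abelian_weyl_group R S -> B != 0 -> weyl_eigen S lam B -> (1 <= alpha)%E ->
  renyi alpha (stab_state S lam) = ln (\rank (stab_proj S lam))%:R.
Proof.
move=> Sab B0 SB a1; apply: renyi_flat => //.
- by split; [exact: (stab_proj_idem d_pr Sab B0 SB)|exact: (adj_stab_proj d_pr Sab B0 SB)].
- exact: (stab_proj_neq0 d_pr Sab B0 SB).
Qed.

Lemma sandwiched_mean_state_lt rho alpha sigma : state rho -> (1 <= alpha)%E ->
  MSPS sigma -> sigma <> mean_state rho ->
  (sandwiched alpha rho (mean_state rho) < sandwiched alpha rho sigma)%E.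
Proof.
move=> st a1 /MSPS_stab_state[S [lam [v [Sab v0 Sv ->]]]] neq.
have Gab := stab_set_group st; have r0 := state_neq0 st; have Gr := stab_eigen st.
move: neq; rewrite (mean_stateE st) => neq.
rewrite (sandwiched_stab_state Gab r0 Gr st a1 Gr).
have [Sr|Sr] := pselect (weyl_eigen S lam rho); last first.
  by rewrite (sandwiched_stab_state_infty _ Sab v0 Sv st Sr) ltry.
have lamE := weyl_eigen_stab_val st Sr.
have sub : S \subset stab_set rho.
  apply/fintype.subsetP => x xS.
  by rewrite (mem_stab_set st) (lamE _ xS) (norm_weyl_eigen d_pr Sab v0 Sv xS) eqxx.
(* Both eigenvalue functions are expectations in rho, so equal groups would give equal states. *)
have S_neq : S != stab_set rho.
  apply/eqP => E; apply: neq; rewrite /stab_state.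
  suff -> : stab_proj S lam = stab_proj (stab_set rho) (stab_val rho) by exact: erefl.
  rewrite /stab_proj -E; congr (_ *: _); apply: eq_bigr => x xS; by rewrite (lamE _ xS).
have cardS : (#|S| < #|stab_set rho|)%N.
  by apply: proper_card; rewrite finset.properEneq S_neq.
rewrite (sandwiched_stab_state Sab v0 Sv st a1 Sr) lte_fin ltrD2r.
have rkS := rank_stab_proj d_pr Sab v0 Sv; have rkG := rank_stab_proj d_pr Gab r0 Gr.
have rpos : (0 < \rank (stab_proj (stab_set rho) (stab_val rho)))%N.
  by rewrite lt0n mxrank_eq0; apply/eqP; exact: (stab_proj_neq0 d_pr Gab r0 Gr).
exact: ln_ltn rpos (ltn_cross_mul (etrans rkS (esym rkG)) cardS rpos).
Qed.

End MeanState.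

Theorem mainTheorem2 (R : realType) (d n : nat) (rho : op R d n)
  (alpha : \bar R) :
  prime d -> (1 <= n)%N -> state rho -> (1 <= alpha)%E ->
  let M := mean_state rho in
  [/\ MSPS M,
      (forall sigma, MSPS sigma -> (sandwiched alpha rho M <= sandwiched alpha rho sigma)%E),
      sandwiched alpha rho M = (renyi alpha M - renyi alpha rho)%:E &
      (forall sigma, MSPS sigma -> sigma <> M ->
         (sandwiched alpha rho M < sandwiched alpha rho sigma)%E)].
Proof.
move=> d_pr _ st a1 M.
have Gab := stab_set_group d_pr st; have r0 := state_neq0 st; have Gr := stab_eigen d_pr st.
have lt_M sigma := @sandwiched_mean_state_lt _ _ _ d_pr rho alpha sigma st a1.
split.
- by rewrite /M (mean_stateE d_pr st); exact: (stab_state_MSPS d_pr Gab r0 Gr).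
- move=> sigma sigmaP; have [->|neq] := pselect (sigma = M); first exact: lexx.
  exact: ltW (lt_M sigma sigmaP neq).
(* The log of the rank in the divergence is the entropy of the flat state M at every order. *)
- rewrite /M (mean_stateE d_pr st) (sandwiched_stab_state d_pr Gab r0 Gr st a1 Gr).
  by rewrite (renyi_stab_state d_pr Gab r0 Gr a1).
- exact: lt_M.
Qed.
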